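(* Let $p\in\mathbb Z[x]$ be a nice antisymmetric polynomial of degree $d\ge3$ with center $C$, having at least two distinct roots. Let $m_0$ be the multiplicity of $C$ as a root of $p$, and let $g=\gcd(m_0,d)$. Then $m_0/g$ and $d/g$ are both squares of odd integers.
   Context: A polynomial $p\in\mathbb Z[x]$ of degree $d\ge2$ is nice if $p$ and its derivative $p'$ both factor as products of linear factors over $\mathbb Z$, i.e. $p(x)=c\prod_{i=1}^d(x-x_i)$ and $p'(x)=c'\prod_{j=1}^{d-1}(x-x'_j)$ with all $c,c',x_i,x'_j\in\mathbb Z$. A non-constant $p\in\mathbb Z[x]$ is antisymmetric if there is $C\in\mathbb Z$ (its center) with $p(C-a)=-p(C+a)$ for all $a\in\mathbb Z$ (so $C$ is a root of $p$). *)

(* Defs.v *)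
From HB Require Import structures.
From mathcomp Require Import all_boot all_order all_algebra.

Set Implicit Arguments.
Unset Strict Implicit.
Unset Printing Implicit Defensive.

Import Order.TTheory GRing.Theory Num.Theory.
Local Open Scope ring_scope.

(* [n] is the number of roots counted with multiplicity. *)
Definition splits_over_Z (n : nat) (q : {poly int}) : Prop :=
  exists (c : int) (x : n.-tuple int), q = c *: \prod_(i < n) ('X - (tnth x i)%:P).

Definition nice (d : nat) (p : {poly int}) : Prop :=
  [/\ (2 <= d)%N, size p = d.+1, splits_over_Z d p & splits_over_Z d.-1 p^`()].

Definition has_center (p : {poly int}) (C : int) : Prop :=
  forall a : int, p.[C - a] = - p.[C + a].

Definition antisymmetric_about (p : {poly int}) (C : int) : Prop :=
  (1 < size p)%N /\ has_center p C.

Definition odd_square (n : nat) : Prop :=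
  exists k : int, n%:Z = (2 * k + 1) ^+ 2.

(* Main.v *)
Require Import Defs.
From HB Require Import structures.
From mathcomp Require Import all_boot all_order all_algebra.
From mathcomp.real_closed Require Import polyorder.

Set Implicit Arguments.
Unset Strict Implicit.
Unset Printing Implicit Defensive.

Import Order.TTheory GRing.Theory Num.Theory.
Local Open Scope ring_scope.

(** Translate so that the center is [0]: then [p] is odd and [p'] is even, so
    the nonzero roots of each come in pairs [z, -z], and the product of the
    nonzero roots is, up to sign, a square.  Hence the lowest coefficient of
    [p] is [+- c A^2] and that of [p'] is [+- d c B^2], where [c] is the leading
    coefficient of [p].  Since the lowest coefficient of [p'] is [m0] times that
    of [p], [m0 A^2 = d B^2].  Finally [d] is odd because [p] is odd, and so is
    [m0], as pairing the nonzero roots shows. *)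

(** Once [A] and [B] are divided by their gcd, their squares are coprime as well, so coprimality on
    both sides makes [a] and the reduced [B ^ 2] divide each other, and likewise [b] and the reduced
    [A ^ 2]. *)
Lemma coprime_mul_sqr_eq (a b A B : nat) :
  coprime a b -> (0 < A)%N -> (a * A ^ 2 = b * B ^ 2)%N ->
  exists A1 B1, a = (B1 ^ 2)%N /\ b = (A1 ^ 2)%N.
Proof.
move=> cab A0 eAB; pose h := gcdn A B.
have h0 : (0 < h)%N by rewrite gcdn_gt0 A0.
have eA : A = (A %/ h * h)%N by rewrite divnK // dvdn_gcdl.
have eB : B = (B %/ h * h)%N by rewrite divnK // dvdn_gcdr.
have cAB : coprime (A %/ h) (B %/ h).
  by rewrite /coprime -(eqn_pmul2r h0) muln_gcdl -eA -eB mul1n.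
have {}eAB : (a * (A %/ h) ^ 2 = b * (B %/ h) ^ 2)%N.
  apply/eqP; rewrite -(@eqn_pmul2r (h ^ 2)%N) ?expn_gt0 ?h0 //.
  by rewrite -(mulnA a) -(mulnA b) -!expnMn -eA -eB eAB.
have c2 : coprime ((A %/ h) ^ 2) ((B %/ h) ^ 2).
  by rewrite coprimeXl // coprimeXr.
exists (A %/ h)%N, (B %/ h)%N.
split; apply/eqP; rewrite eqn_dvd; apply/andP; split.
- by rewrite -(Gauss_dvdr _ cab) -eAB dvdn_mulr.
- by rewrite -(@Gauss_dvdl _ _ ((A %/ h) ^ 2)%N) 1?coprime_sym // eAB dvdn_mull.
- by rewrite -(@Gauss_dvdr _ a) 1?coprime_sym // eAB dvdn_mulr.
- by rewrite -(@Gauss_dvdl _ _ ((B %/ h) ^ 2)%N) // -eAB dvdn_mull.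
Qed.

Lemma odd_square_sqr (n : nat) : odd n -> odd_square (n ^ 2).
Proof.
move=> n_odd; exists n./2%:Z.
rewrite -[in LHS](odd_double_half n) n_odd addnC -mul2n -mulnn expr2.
by rewrite PoszM PoszD PoszM.
Qed.

(** This turns the pointwise symmetry about the center into a polynomial identity: a nonzero
    difference cannot vanish at as many integers as its size. *)
Lemma poly_int_ext (p q : {poly int}) :
  (forall a : int, p.[a] = q.[a]) -> p = q.
Proof.
move=> epq; apply/eqP; rewrite -subr_eq0; apply/eqP.
apply: (@roots_geq_poly_eq0 _ _ [seq i%:Z | i <- iota 0 (size (p - q))]).
- by apply/allP => x _; rewrite /root hornerD hornerN epq subrr.
- by rewrite map_inj_uniq ?iota_uniq // => i j [].
- by rewrite size_map size_iota.
Qed.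

Lemma mu_prod_XsubC_seq (R : idomainType) (s : seq R) (x : R) :
  \mu_x (\prod_(z <- s) ('X - z%:P)) = count_mem x s.
Proof.
elim: s => [|z s IHs]; first by rewrite big_nil mu_polyC.
rewrite big_cons mu_mul; last first.
  by rewrite mulf_neq0 ?polyXsubC_eq0 // monic_neq0 // monic_prod_XsubC.
rewrite IHs /=; congr (_ + _)%N; have [->|zx] := eqVneq z x.
  exact: mu_XsubC.
by rewrite muNroot // root_XsubC eq_sym.
Qed.

(** Substituting [- 'X] negates every root up to a global sign, and nonzero scalars do not affect
    multiplicities; so each [x] is counted equally often in both lists. *)
Lemma perm_opp_roots (s : seq int) (e : int) :
  let q := \prod_(z <- s) ('X - z%:P) in
  e != 0 -> q \Po (- 'X) = e *: q -> perm_eq s (map -%R s).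
Proof.
move=> q e0 eq; apply/allP => x _ /=; apply/eqP.
rewrite -!mu_prod_XsubC_seq -/q -(mu_mulC _ x e0) -eq.
have -> : q \Po - 'X = (-1) ^+ size s *: \prod_(z <- map -%R s) ('X - z%:P).
  rewrite big_map /q.
  elim: (s) => [|z t IHt]; first by rewrite !big_nil expr0 scale1r comp_polyC.
  rewrite !big_cons comp_polyM IHt comp_polyB comp_polyX comp_polyC exprS.
  by rewrite -scalerA scaleN1r -scalerAr -scalerN -mulNr opprD !polyCN opprK.
by rewrite mu_mulC // signr_eq0.
Qed.

(** Negation exchanges the positive and negative entries, so both contribute the same absolute
    product [A]. The factors are [- z] because these are the constant terms of ['X - z%:P]. *)
Lemma prod_perm_opp (s : seq int) : perm_eq s (map -%R s) ->
  exists2 A : nat, (0 < A)%N & `|\prod_(z <- s | z != 0) - z| = (A ^ 2)%:Z.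
Proof.
move=> s_opp; exists (\prod_(z <- s | (0 < z)%R) `|z|)%N.
  by rewrite prodn_cond_gt0 // => z z0; rewrite absz_gt0 gt_eqF.
rewrite normr_prod (bigID (fun z : int => 0 < z)) /=.
have -> : \prod_(z <- s | (z != 0) && ~~ (0 < z)) `|- z| =
          \prod_(z <- s | (z != 0) && (0 < z)) `|- z|.
  rewrite (perm_big _ s_opp) big_map /=; apply: eq_big => z.
    by rewrite oppr_eq0 oppr_gt0; case: ltrgt0P.
  by rewrite opprK normrN.
rewrite -expr2 -mulnn PoszM -expr2; congr (_ ^+ 2).
rewrite (eq_bigl (fun z : int => 0 < z)); last first.
  by move=> z; case: ltrgt0P.
by rewrite -natz natr_prod; apply: eq_bigr => z _; rewrite normrN natz abszE.
Qed.

Lemma odd_size_perm_opp (s : seq int) :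
  perm_eq s (map -%R s) -> odd (size s) = odd (count_mem 0 s).
Proof.
pose pos (z : int) := 0 < z; pose neg (z : int) := z < 0.
move=> s_opp; rewrite -(count_predC (pred1 0)) oddD.
have -> : count (predC (pred1 0)) s = (count pos s).*2.
  have -> : count (predC (pred1 0)) s = (count pos s + count neg s)%N.
    elim: (s) => //= z t ->; rewrite -[pos z]/(0 < z) -[neg z]/(z < 0).
    by case: ltrgt0P => _; rewrite ?add0n -?addnA // addnCA.
  rewrite -addnn; congr (_ + _)%N.
  rewrite (permP s_opp) count_map; apply: eq_count => z /=.
  by rewrite /neg oppr_lt0.
by rewrite odd_double addbF.
Qed.

Lemma prod_XsubC_split0 (s : seq int) :
  \prod_(z <- s) ('X - z%:P) =
  'X^(count_mem 0 s) * \prod_(z <- s | z != 0) ('X - z%:P).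
Proof.
rewrite (bigID (pred1 0)) /=; congr (_ * _).
rewrite (eq_bigr (fun=> 'X)) ?big_const_seq ?iter_mulr_1 // => z /eqP->.
by rewrite subr0.
Qed.

(** The scalar [e] lets one statement serve both the odd polynomial ([e = -1]) and its even
    derivative ([e = 1]). *)
Lemma lowest_coef_even_or_odd_split (n : nat) (q : {poly int}) (e : int) :
    size q = n.+1 -> splits_over_Z n q -> e != 0 -> q \Po (- 'X) = e *: q ->
  let k := \mu_0 q in
  odd n = odd k /\
  exists2 A : nat, (0 < A)%N & `|q`_k| = `|lead_coef q| * (A ^ 2)%:Z.
Proof.
move=> size_q [c [x]].
rewrite -(big_tuple _ _ _ xpredT (fun z => 'X - z%:P)) => eq_q e0.
have c0 : c != 0.
  by apply: contra_eqN size_q => /eqP c0; rewrite eq_q c0 scale0r size_poly0.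
rewrite eq_q comp_polyZ !scalerA [e * c]mulrC -scalerA -!(mul_polyC c).
have cP0 : c%:P != 0 by rewrite polyC_eq0.
move=> /(mulfI cP0) /(perm_opp_roots e0) s_opp.
rewrite mul_polyC mu_mulC // mu_prod_XsubC_seq /=.
split; first by rewrite -odd_size_perm_opp // size_tuple.
have [A A0 eA] := prod_perm_opp s_opp; exists A => //.
rewrite lead_coefZ lead_coef_prod_XsubC mulr1 coefZ normrM -eA.
(* With the power of ['X] split off, the lowest coefficient is the value at 0 of the product over
   the nonzero roots. *)
rewrite prod_XsubC_split0 coefXnM ltnn subnn -horner_coef0 horner_prod.
by under eq_bigr do rewrite hornerXsubC sub0r.
Qed.

Lemma splits_over_Z_shift (n : nat) (q : {poly int}) (C : int) :
  splits_over_Z n q -> splits_over_Z n (q \Po ('X + C%:P)).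
Proof.
move=> [c [x ->]]; exists c, [tuple of map (+%R^~ (- C)) x].
rewrite comp_polyZ rmorph_prod /=; congr (_ *: _); apply: eq_bigr => i _.
by rewrite tnth_map comp_polyB comp_polyX comp_polyC polyCB opprB addrA.
Qed.

Lemma mu_shift (p : {poly int}) (C : int) :
  p != 0 -> \mu_0 (p \Po ('X + C%:P)) = \mu_C p.
Proof.
move=> p0; have [q qC {1}->] := mu_spec C p0.
have XC : ('X - C%:P) \Po ('X + C%:P) = 'X - 0%:P :> {poly int}.
  by rewrite comp_polyB comp_polyX comp_polyC addrK subr0.
have qC0 : ~~ root (q \Po ('X + C%:P)) 0.
  by rewrite /root horner_comp !hornerE.
have q0 : q \Po ('X + C%:P) != 0 by apply: contraNneq qC0 => ->; exact: root0.
rewrite comp_polyM rmorphXn /= XC mu_mul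
  ?mulf_neq0 ?expf_neq0 ?polyXsubC_eq0 //.
by rewrite muNroot // mu_exp mu_XsubC mul1n.
Qed.

Theorem theorem5p1 (p : {poly int}) (d : nat) (C : int)
    (hnice : nice d p) (hd : (3 <= d)%N) (hanti : antisymmetric_about p C)
    (hroots : exists x y : int, [/\ x != y, root p x & root p y]) :
  let m0 := \mu_C p in
  let g := gcdn m0 d in
  odd_square (m0 %/ g) /\ odd_square (d %/ g).
Proof.
move=> m0 g; have [d2 size_p p_split dp_split] := hnice.
have [_ p_center] := hanti.
have p0 : p != 0 by rewrite -size_poly_eq0 size_p.
pose r := p \Po ('X + C%:P).
have dr : r^`() = p^`() \Po ('X + C%:P).
  by rewrite /r deriv_comp derivD derivX derivC addr0 mulr1.
have size_r : size r = d.+1 by rewrite size_comp_poly2 ?size_XaddC.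
have size_dr : size r^`() = d.-1.+1 by rewrite size_deriv size_r prednK // ltnW.
have r_odd : r \Po (- 'X) = -1 *: r.
  apply: poly_int_ext => a.
  rewrite /r hornerZ !horner_comp !hornerE [- a + C]addrC p_center.
  by rewrite [a + C]addrC mulN1r.
have dr_even : r^`() \Po (- 'X) = 1 *: r^`().
  (* Differentiate [r_odd]; the chain rule supplies the sign. *)
  apply: oppr_inj; rewrite scale1r -derivN -[- r]scaleN1r -r_odd (deriv_comp r).
  by rewrite derivN derivX mulrN1.
have r_split : splits_over_Z d r by apply: splits_over_Z_shift.
have dr_split : splits_over_Z d.-1 r^`().
  by rewrite dr; apply: splits_over_Z_shift.
have [odd_d [A A0 eA]] :=
  lowest_coef_even_or_odd_split (e := -1) size_r r_split isT r_odd.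
have [_ [B B0 eB]] :=
  lowest_coef_even_or_odd_split (e := 1) size_dr dr_split isT dr_even.
have r0 : r != 0 by rewrite -size_poly_eq0 size_r.
have lead_r : lead_coef r != 0 by rewrite lead_coef_eq0.
have d_odd : odd d.
  (* Comparing leading coefficients in [r_odd] gives [(-1) ^+ d = -1]. *)
  have := congr1 lead_coef r_odd.
  rewrite lead_coef_comp ?size_polyN ?size_polyX // lead_coefN lead_coefX.
  rewrite size_r lead_coefZ mulrC => /(mulIf lead_r) /eqP; rewrite -signr_odd.
  by case: (odd d).
have m0E : \mu_0 r = m0 by rewrite mu_shift.
rewrite m0E in odd_d eA.
have m0_odd : odd m0 by rewrite -odd_d.
(* Being odd, [m0] is positive; at an actual root, differentiation lowers the multiplicity by
   exactly one. *)
have root_r : root r 0 by rewrite -mu_gt0 // m0E odd_gt0.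
have mu_dr : (\mu_0 r^`()).+1 = m0 by rewrite -addn1 -mu_deriv_root.
have main : (m0 * A ^ 2 = d * B ^ 2)%N.
  (* Differentiation multiplies the lowest coefficient of [r] by [m0] and the leading one by [d];
     the common factor [lead_coef r] then cancels in absolute value. *)
  move: eB; rewrite coef_deriv mu_dr normrMn eA.
  rewrite [lead_coef r^`()]lead_coefE size_dr /= coef_deriv.
  rewrite prednK 1?ltnW // normrMn.
  have -> : r`_d = lead_coef r by rewrite lead_coefE size_r.
  rewrite -mulr_natr -[X in _ = X * _]mulr_natr -!mulrA.
  move=> /(mulfI _) H; have {H} := H _; rewrite normr_eq0 => /(_ lead_r).
  by rewrite !natz -!PoszM => -[]; rewrite mulnC.
have g0 : (0 < g)%N by rewrite gcdn_gt0 odd_gt0.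
have m0g : (m0 %/ g * g = m0)%N by rewrite divnK // dvdn_gcdl.
have dg : (d %/ g * g = d)%N by rewrite divnK // dvdn_gcdr.
have cop : coprime (m0 %/ g) (d %/ g).
  by rewrite /coprime -(eqn_pmul2r g0) muln_gcdl m0g dg mul1n.
have [|A1 [B1 [em ed]]] := coprime_mul_sqr_eq cop A0 (B := B).
  by apply/eqP; rewrite -(eqn_pmul2r g0) mulnAC m0g main -{1}dg mulnAC.
split.
  (* [B1 ^ 2] divides the odd number [m0], so [B1] is odd; the same argument applies to [A1] and
     [d]. *)
  rewrite em; apply: odd_square_sqr.
  by move: m0_odd; rewrite -m0g em oddM oddX => /andP[].
rewrite ed; apply: odd_square_sqr.
by move: d_odd; rewrite -dg ed oddM oddX => /andP[].
Qed.
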